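(* Let $m\geq2$. Then (a) \[ \sum_{n=0}^{\infty}\frac{A_{12\cdots m,n}^{(\mathrm{ides},\mathrm{imaj})}(t,q)}{\prod_{i=0}^{n}(1-tq^{i})}x^{n}=\sum_{n=0}^{\infty}\left(\frac{tx}{(1-t)(1-tq)}-\sum_{j=1}^{\infty}\left(\frac{tx^{jm}}{\prod_{i=0}^{jm}(1-tq^{i})}-\frac{tx^{jm+1}}{\prod_{i=0}^{jm+1}(1-tq^{i})}\right)\right)^{*\langle n\rangle} \] and (b) \[ \sum_{n=0}^{\infty}\frac{A_{12\cdots m,n}^{(\mathrm{ides},\mathrm{imaj})}(t,q)}{\prod_{i=0}^{n}(1-tq^{i})}x^{n}=1+\sum_{k=1}^{\infty}\left[\sum_{j=0}^{\infty}\left({k+jm-1 \choose k-1}_{\!q}x^{jm}-{k+jm \choose k-1}_{\!q}x^{jm+1}\right)\right]^{-1}t^{k}. \]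
   Context: $\mathfrak{S}_n$ is the set of permutations of $[n]$ in one-line notation. $\operatorname{std}$ of a sequence of distinct integers replaces its letters by $1,2,\dots$ in order of size. A permutation $\pi\in\mathfrak{S}_n$ avoids $\sigma\in\mathfrak{S}_m$ (as a consecutive pattern) if there is no $i\in[n-m+1]$ with $\operatorname{std}(\pi_i\cdots\pi_{i+m-1})=\sigma$. A descent of $\pi$ is $i\in[n-1]$ with $\pi_i>\pi_{i+1}$; $\operatorname{des}(\pi)$ is the number of descents, $\operatorname{maj}(\pi)$ their sum; $\operatorname{ides}(\pi)=\operatorname{des}(\pi^{-1})$, $\operatorname{imaj}(\pi)=\operatorname{maj}(\pi^{-1})$. $A_{12\cdots m,n}^{(\mathrm{ides},\mathrm{imaj})}(t,q)=\sum t^{\operatorname{ides}(\pi)+1}q^{\operatorname{imaj}(\pi)}$ over $\pi\in\mathfrak{S}_n$ avoiding $12\cdots m$, for $n\ge1$, and $=1$ for $n=0$. $[n]_q!=\prod_{k=1}^n(1+q+\cdots+q^{k-1})$, $[0]_q!=1$, ${n\choose k}_q=[n]_q!/([k]_q![n-k]_q!)$. In (a), the right side is computed in formal power series in $t,q,x$ with ordinary multiplication in $q,x$ and the Hadamard product in $t$: $(\sum_n a_nt^n)*(\sum_n b_nt^n)=\sum_n a_nb_nt^n$; $f^{*\langle n\rangle}$ is the $n$-fold Hadamard product, $f^{*\langle0\rangle}=1/(1-t)$. In (b), the inverse $[\cdot]^{-1}$ is the ordinary multiplicative inverse in $\mathbb{Q}[[q,x]]$. All other expressions use ordinary multiplication.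 *)

(* Defs.v *)
(* boolp and classical_sets only supply function extensionality and choice
   for the type of formal power series. *)
From HB Require Import structures.
From mathcomp Require Import all_boot all_order all_fingroup all_algebra.
From mathcomp Require Import boolp classical_sets.

Set Implicit Arguments.
Unset Strict Implicit.
Unset Printing Implicit Defensive.

Import GRing.Theory.
Local Open Scope ring_scope.

Record fps (R : Type) := Fps { fps_coef : nat -> R }.

Notation "\fps_ ( n ) E" := (Fps (fun n : nat => E))
  (at level 36, n name, E at level 36, format "\fps_ ( n )  E") : ring_scope.

Notation "[coef n ] f" := (fps_coef f n%N)
  (at level 9, n at level 99, f at level 8, format "[coef  n ]  f")
  : ring_scope.

Lemma fpsP (R : Type) (f g : fps R) :
  (forall n, [coef n] f = [coef n] g) <-> f = g.
Proof.
split=> [|->//]; case: f => f; case: g => g /= fg.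
by congr Fps; apply: funext.
Qed.

HB.instance Definition _ (R : Type) := gen_eqMixin (fps R).
HB.instance Definition _ (R : Type) := gen_choiceMixin (fps R).

Section Zmodule.
Variable R : zmodType.
Implicit Types f g h : fps R.

Definition fps_zero : fps R := \fps_(n) 0.
Definition fps_opp f : fps R := \fps_(n) - [coef n] f.
Definition fps_add f g : fps R := \fps_(n) ([coef n] f + [coef n] g).

Fact fps_addA : associative fps_add.
Proof. by move=> f g h; apply/fpsP => n /=; rewrite addrA. Qed.
Fact fps_addC : commutative fps_add.
Proof. by move=> f g; apply/fpsP => n /=; rewrite addrC. Qed.
Fact fps_add0 : left_id fps_zero fps_add.
Proof. by move=> f; apply/fpsP => n /=; rewrite add0r. Qed.
Fact fps_addN : left_inverse fps_zero fps_opp fps_add.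
Proof. by move=> f; apply/fpsP => n /=; rewrite addNr. Qed.

HB.instance Definition _ :=
  GRing.isZmodule.Build (fps R) fps_addA fps_addC fps_add0 fps_addN.

End Zmodule.

Section Ring.
Variable R : comNzRingType.
Implicit Types f g h : fps R.

Definition fpsC (c : R) : fps R := \fps_(n) (if n == 0%N then c else 0).
Definition fpsX : fps R := \fps_(n) (n == 1%N)%:R.
Definition fps_mul f g : fps R :=
  \fps_(n) (\sum_(i < n.+1) [coef i] f * [coef n - i] g).

Definition fps_trunc (n : nat) f : {poly R} := \poly_(i < n.+1) [coef i] f.

Fact fps_mul_trunc f g n k : (k <= n)%N ->
  [coef k] (fps_mul f g) = (fps_trunc n f * fps_trunc n g)`_k.
Proof.
move=> kn; rewrite coefM /=; apply: eq_bigr => i _.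
rewrite !coef_poly !ltnS (leq_trans _ kn) ?leq_ord //.
by rewrite (leq_trans (leq_subr _ _) kn).
Qed.

Fact fps_mulC : commutative fps_mul.
Proof.
by move=> f g; apply/fpsP => n; rewrite !(fps_mul_trunc _ _ (leqnn n)) mulrC.
Qed.

Fact fps_mulA : associative fps_mul.
Proof.
move=> f g h; apply/fpsP => n.
transitivity (fps_trunc n f * (fps_trunc n g * fps_trunc n h))`_n.
  rewrite coefM; apply: eq_bigr => i _.
  by rewrite (fps_mul_trunc _ _ (leq_subr _ _)) coef_poly ltn_ord.
rewrite mulrA coefM; apply: eq_bigr => i _.
by rewrite (fps_mul_trunc _ _ (leq_ord i)) coef_poly ltnS leq_subr.
Qed.

Fact fps_mul1 : left_id (fpsC 1) fps_mul.
Proof.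
move=> f; apply/fpsP => n /=.
by rewrite big_ord_recl /= mul1r subn0 big1 ?addr0 // => i _; rewrite mul0r.
Qed.

Fact fps_mulDl : left_distributive fps_mul +%R.
Proof.
move=> f g h; apply/fpsP => n /=.
by rewrite -big_split; apply: eq_bigr => i _; rewrite mulrDl.
Qed.

Fact fps_oner_neq0 : fpsC 1 != 0.
Proof.
by apply/eqP => /fpsP/(_ 0%N) /= /eqP; rewrite oner_eq0.
Qed.

HB.instance Definition _ := GRing.Zmodule_isComNzRing.Build (fps R)
  fps_mulA fps_mulC fps_mul1 fps_mulDl fps_oner_neq0.

End Ring.

Arguments fpsX {R}.

Section UnitRing.
Variable R : comUnitRingType.
Implicit Types f g : fps R.

(* first n.+1 coefficients of the inverse of f, solving f * g = 1 for g *)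
Fixpoint fps_inv_seq f (n : nat) : seq R :=
  if n is n'.+1 then
    let s := fps_inv_seq f n' in
    rcons s (- ([coef 0] f)^-1 * \sum_(i < n) [coef n - i] f * s`_i)
  else [:: ([coef 0] f)^-1].

Definition fps_unit : {pred fps R} := fun f => [coef 0] f \is a GRing.unit.
Definition fps_inv f : fps R :=
  if f \in fps_unit then \fps_(n) (fps_inv_seq f n)`_n else f.

Fact size_fps_inv_seq f n : size (fps_inv_seq f n) = n.+1.
Proof. by elim: n => //= n IHn; rewrite size_rcons IHn. Qed.

Fact fps_inv_seq_nth f n i :
  (i <= n)%N -> (fps_inv_seq f n)`_i = (fps_inv_seq f i)`_i.
Proof.
elim: n => [|n IHn]; first by rewrite leqn0 => /eqP->.
rewrite leq_eqVlt => /predU1P[->//|]; rewrite ltnS => lein /=.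
by rewrite nth_rcons size_fps_inv_seq ltnS lein IHn.
Qed.

Fact fps_mulV : {in fps_unit, left_inverse 1 fps_inv *%R}.
Proof.
move=> f uf; rewrite /fps_inv uf; apply/fpsP => -[|n].
  by rewrite /= big_ord1 /= mulVr.
rewrite [RHS]/= [LHS]/= big_ord_recr /= subnn.
rewrite nth_rcons size_fps_inv_seq ltnn eqxx mulNr mulNr mulrAC mulVr // mul1r.
apply/eqP; rewrite subr_eq0; apply/eqP; apply: eq_bigr => i _.
by rewrite mulrC (@fps_inv_seq_nth f n i) // -ltnS.
Qed.

Fact fps_unitPl f g : g * f = 1 -> f \in fps_unit.
Proof.
move=> /fpsP/(_ 0%N) /=; rewrite big_ord1 subnn => gf1.
by apply/unitrPr; exists ([coef 0] g); rewrite mulrC.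
Qed.

Fact fps_inv_out : {in [predC fps_unit], fps_inv =1 id}.
Proof. by move=> f /negbTE uf; rewrite /fps_inv uf. Qed.

HB.instance Definition _ := GRing.ComNzRing_hasMulInverse.Build (fps R)
  fps_mulV fps_unitPl fps_inv_out.

End UnitRing.

(* Q[[q]], Q[[q,x]] = Q[[q]][[x]] and Q[[q,x,t]] = Q[[q,x]][[t]]; the variable
   t is outermost so that the Hadamard product in t is the product of
   coefficients.  The digit in q1, q2, q3, x2, x3, t3 is the number of
   variables of the ring in which the variable is taken. *)
Notation Qq := (fps rat).
Notation Qqx := (fps Qq).
Notation Qqxt := (fps Qqx).

Definition q1 : Qq := fpsX.
Definition q2 : Qqx := fpsC q1.
Definition x2 : Qqx := fpsX.
Definition q3 : Qqxt := fpsC q2.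
Definition x3 : Qqxt := fpsC x2.
Definition t3 : Qqxt := fpsX.

(* Infinite sums converge formally: every coefficient of the sequence of
   partial sums is eventually constant. *)
Definition ev_const (T : Type) (u : nat -> T) (l : T) :=
  exists N, forall n, (N <= n)%N -> u n = l.

Definition fps_lim2 (u : nat -> Qqx) (l : Qqx) :=
  forall a b, ev_const (fun n => [coef a] ([coef b] (u n)))
                       ([coef a] ([coef b] l)).

Definition fps_lim3 (u : nat -> Qqxt) (l : Qqxt) :=
  forall a b c, ev_const (fun n => [coef a] ([coef b] ([coef c] (u n))))
                         ([coef a] ([coef b] ([coef c] l))).

Definition sums_to2 (u : nat -> Qqx) (s : Qqx) :=
  fps_lim2 (fun n => \sum_(i < n) u i) s.
Definition sums_to3 (u : nat -> Qqxt) (s : Qqxt) :=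
  fps_lim3 (fun n => \sum_(i < n) u i) s.

Definition summable2 (u : nat -> Qqx) := exists s, sums_to2 u s.
Definition summable3 (u : nat -> Qqxt) := exists s, sums_to3 u s.

(* The value is meaningful only for summable families, and is 0 otherwise. *)
Definition fps_sum2 (u : nat -> Qqx) : Qqx := xget 0 [set s | sums_to2 u s].
Definition fps_sum3 (u : nat -> Qqxt) : Qqxt := xget 0 [set s | sums_to3 u s].

Lemma ev_const_unique (T : Type) (u : nat -> T) (l l' : T) :
  ev_const u l -> ev_const u l' -> l = l'.
Proof.
move=> [N uN] [N' uN'].
by rewrite -(uN (maxn N N')) ?leq_maxl // (uN' (maxn N N')) ?leq_maxr.
Qed.

Lemma fps_sum2P (u : nat -> Qqx) (s : Qqx) : sums_to2 u s -> fps_sum2 u = s.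
Proof.
move=> us; apply: xget_unique => //= s' us'.
apply/fpsP => b; apply/fpsP => a; exact: ev_const_unique (us' a b) (us a b).
Qed.

Lemma fps_sum3P (u : nat -> Qqxt) (s : Qqxt) : sums_to3 u s -> fps_sum3 u = s.
Proof.
move=> us; apply: xget_unique => //= s' us'.
apply/fpsP => c; apply/fpsP => b; apply/fpsP => a.
exact: ev_const_unique (us' a b c) (us a b c).
Qed.

Definition hadamard (f g : Qqxt) : Qqxt := \fps_(k) ([coef k] f * [coef k] g).

Definition hadamard_exp (f : Qqxt) (n : nat) : Qqxt :=
  iter n (hadamard f) (1 - t3)^-1.

Definition qfact (n : nat) : Qq := \prod_(1 <= k < n.+1) \sum_(i < k) q1 ^+ i.
Definition qbinom (n k : nat) : Qq := qfact n / (qfact k * qfact (n - k)).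

Definition oneline (n : nat) (s : 'S_n) : seq nat :=
  [seq (s i).+1 | i <- enum 'I_n].

Definition std (w : seq nat) : seq nat :=
  [seq count (fun b => b <= a)%N w | a <- w].

Definition avoids (n m : nat) (s : 'S_n) (p : 'S_m) : bool :=
  ~~ has (fun i => std (take m (drop i (oneline s))) == oneline p)
         (iota 0 (n.+1 - m)).

(* 12...m *)
Definition incr_perm (m : nat) : 'S_m := 1%g.

(* Positions are 1-based: i is a descent when w_i > w_(i+1). *)
Definition descents (w : seq nat) : seq nat :=
  [seq i <- iota 1 (size w).-1 | nth 0 w i < nth 0 w i.-1]%N.

Definition des (n : nat) (s : 'S_n) : nat := size (descents (oneline s)).
Definition maj (n : nat) (s : 'S_n) : nat := sumn (descents (oneline s)).
Definition ides (n : nat) (s : 'S_n) : nat := des s^-1%g.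
Definition imaj (n : nat) (s : 'S_n) : nat := maj s^-1%g.

(* A_{p,n}^{(ides,imaj)}(t,q), viewed in Q[[q,x,t]] *)
Definition A_ides_imaj (m : nat) (p : 'S_m) (n : nat) : Qqxt :=
  if n == 0%N then 1
  else \sum_(s : 'S_n | avoids s p) t3 ^+ (ides s).+1 * q3 ^+ imaj s.

(* Main.v *)
(* Expanding in powers of t, the coefficient of t^k x^n on the left is the
   q^(sum of letters)-weighted number of words of length n over {0,...,k-1}
   without m consecutive weakly decreasing letters.  Indeed, when words are
   standardized from the largest letter down, ties being broken from left to
   right, pi_i < pi_(i+1) means w_i >= w_(i+1), and the words standardizing to
   pi are enumerated by t^(ides+1) q^imaj / ((1-t)...(1-tq^n)): these are
   MacMahon's P-partitions of a chain labelled by pi^-1.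

   For fixed k, these words have generating function 1/B_k with
   B_k = sum_j (h_(jm) x^(jm) - h_(jm+1) x^(jm+1)), where h_a enumerates weakly
   decreasing words: each nonempty word contributes zero in total to the signed
   count of its factorizations into a weakly decreasing prefix and an avoiding
   suffix.  As h_a is the q-binomial [k+a-1 choose k-1], this is (b); as
   t/((1-t)...(1-tq^a)) has t^k-coefficient h_a, the series on the right of (a)
   has t^k-coefficient 1 - B_k, and Hadamard powers sum to 1/B_k. *)
Require Import Defs.
From mathcomp Require Import all_boot all_order all_fingroup all_algebra.
From mathcomp Require Import zify ring.

Set Implicit Arguments.
Unset Strict Implicit.
Unset Printing Implicit Defensive.

Import GRing.Theory.
Local Open Scope ring_scope.

(** * Coefficients of power series *)

Section FpsCoef.
Variable R : comNzRingType.
Implicit Types (f g : fps R) (c : R).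

Lemma coef_fpsD f g n : [coef n] (f + g) = [coef n] f + [coef n] g.
Proof. by []. Qed.

Lemma coef_fpsN f n : [coef n] (- f) = - [coef n] f.
Proof. by []. Qed.

Lemma coef_fpsB f g n : [coef n] (f - g) = [coef n] f - [coef n] g.
Proof. by []. Qed.

Lemma coef_fpsM f g n :
  [coef n] (f * g) = \sum_(i < n.+1) [coef i] f * [coef n - i] g.
Proof. by []. Qed.

Lemma coef_fpsC c n : [coef n] (fpsC c) = if n == 0%N then c else 0.
Proof. by []. Qed.

Lemma coef_fps1 n : [coef n] (1 : fps R) = (n == 0%N)%:R.
Proof. by rewrite [LHS]/=; case: eqP. Qed.

Lemma coef_fps_sum (I : Type) (r : seq I) (P : pred I) (F : I -> fps R) n :
  [coef n] (\sum_(i <- r | P i) F i) = \sum_(i <- r | P i) [coef n] (F i).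
Proof. by elim/big_rec2: _ => // i y1 y2 _ <-. Qed.

Lemma coef0_fpsM f g : [coef 0] (f * g) = [coef 0] f * [coef 0] g.
Proof. by rewrite coef_fpsM big_ord1. Qed.

Lemma coef_fpsCM c f n : [coef n] (fpsC c * f) = c * [coef n] f.
Proof.
rewrite coef_fpsM big_ord_recl subn0 big1 ?addr0 // => i _.
by rewrite coef_fpsC mul0r.
Qed.

Lemma coef0_fpsXM f : [coef 0] (fpsX * f) = 0.
Proof. by rewrite coef0_fpsM mul0r. Qed.

Lemma coefS_fpsXM f n : [coef n.+1] (fpsX * f) = [coef n] f.
Proof.
rewrite coef_fpsM big_ord_recl mul0r add0r big_ord_recl subSS subn0 mul1r.
by rewrite big1 ?addr0 // => i _; rewrite mul0r.
Qed.

Lemma coef_fpsXnM f i n :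
  [coef n] (fpsX ^+ i * f) = if (i <= n)%N then [coef n - i] f else 0.
Proof.
elim: i n => [|i IHi] n; first by rewrite expr0 mul1r subn0.
rewrite exprS -mulrA; case: n => [|n]; first by rewrite coef0_fpsXM.
by rewrite coefS_fpsXM IHi.
Qed.

Lemma coef_fpsXn i n : [coef n] (fpsX ^+ i : fps R) = (n == i)%:R.
Proof.
rewrite -[fpsX ^+ i]mulr1 coef_fpsXnM coef_fps1 subn_eq0 eqn_leq.
by rewrite andbC; case: (_ <= _)%N.
Qed.

Lemma fpsC0 : fpsC 0 = 0 :> fps R.
Proof. by apply/fpsP => n; rewrite coef_fpsC if_same. Qed.

Lemma fpsCD : {morph @fpsC R : c d / c + d}.
Proof.
by move=> c d; apply/fpsP => n; rewrite coef_fpsD !coef_fpsC; case: eqP;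
  rewrite ?addr0.
Qed.

Lemma fpsCN : {morph @fpsC R : c / - c}.
Proof.
by move=> c; apply/fpsP => n; rewrite coef_fpsN !coef_fpsC; case: eqP;
  rewrite ?oppr0.
Qed.

Lemma fpsCM : {morph @fpsC R : c d / c * d}.
Proof.
by move=> c d; apply/fpsP => n; rewrite coef_fpsCM !coef_fpsC; case: eqP;
  rewrite ?mulr0.
Qed.

Lemma fpsCX c n : fpsC (c ^+ n) = fpsC c ^+ n.
Proof. by elim: n => // n IHn; rewrite !exprS fpsCM IHn. Qed.

Lemma fpsC_sum (I : Type) (r : seq I) (P : pred I) (F : I -> R) :
  fpsC (\sum_(i <- r | P i) F i) = \sum_(i <- r | P i) fpsC (F i).
Proof. exact: (big_morph _ fpsCD fpsC0). Qed.

Lemma coef_fps_exp_eq0 f n i :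
  [coef 0] f = 0 -> (i < n)%N -> [coef i] (f ^+ n) = 0.
Proof.
move=> f0; elim: n i => // n IHn i lt_in.
rewrite exprS coef_fpsM big_ord_recl f0 mul0r add0r big1 // => j _.
by rewrite IHn ?mulr0 // lift0; have := ltn_ord j; lia.
Qed.

End FpsCoef.

Lemma coef0_prod (R : comNzRingType) (I : Type) (r : seq I) (F : I -> fps R) :
  [coef 0] (\prod_(i <- r) F i) = \prod_(i <- r) [coef 0] (F i).
Proof. by elim/big_rec2: _ => // i y1 y2 _ <-; rewrite coef0_fpsM. Qed.

(** * Weighted sums over words *)

Section WordSums.

(** [F] takes plain sequences rather than tuples, so that one [F] serves every alphabet and length
    and applies to prefixes and suffixes. *)
Definition wsum (k n : nat) (F : seq nat -> Qq) : Qq :=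
  \sum_(w : n.-tuple 'I_k)
    q1 ^+ (\sum_(a <- w) a) * F [seq val a | a <- w].

Variable k : nat.
Implicit Types F G : seq nat -> Qq.

Lemma eq_wsum n F G : (forall s, size s = n -> F s = G s) ->
  wsum k n F = wsum k n G.
Proof.
by move=> FG; apply: eq_bigr => w _; rewrite FG // size_map size_tuple.
Qed.

Lemma wsum0 F : wsum k 0 F = F [::].
Proof.
rewrite /wsum (big_pred1 [tuple]); last first.
  by move=> w; apply/esym/eqP; exact: tuple0.
by rewrite big_nil mul1r.
Qed.

Lemma wsumS n F :
  wsum k n.+1 F = \sum_(a < k) q1 ^+ a * wsum k n (fun s => F (val a :: s)).
Proof.
rewrite /wsum; under [RHS]eq_bigr do rewrite big_distrr.
rewrite pair_big /=.
rewrite (reindex (fun p : 'I_k * n.-tuple 'I_k => [tuple of p.1 :: p.2])) /=.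
  by apply: eq_bigr => -[a w] _; rewrite big_cons /= exprD -mulrA.
exists (fun w => (thead w, [tuple of behead w])) => [[a w]|w] _.
  by rewrite /= theadE; congr pair; apply: val_inj.
by apply: val_inj; rewrite [in RHS](tuple_eta w).
Qed.

Lemma wsumZ n c F : wsum k n (fun s => c * F s) = c * wsum k n F.
Proof. by rewrite /wsum mulr_sumr; apply: eq_bigr => w _; rewrite mulrCA. Qed.

Lemma wsum_sum n (I : Type) (r : seq I) (P : pred I) (F : I -> seq nat -> Qq) :
  wsum k n (fun s => \sum_(i <- r | P i) F i s) =
  \sum_(i <- r | P i) wsum k n (F i).
Proof.
by rewrite /wsum exchange_big; apply: eq_bigr => w _; rewrite mulr_sumr.
Qed.

(** The weight of a word is multiplicative under concatenation. *)
Lemma wsum_cat a b F G :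
  wsum k (a + b) (fun s => F (take a s) * G (drop a s)) =
  wsum k a F * wsum k b G.
Proof.
elim: a F => [|a IHa] F.
  by rewrite wsum0 -wsumZ; apply: eq_wsum => s _; rewrite take0 drop0.
rewrite addSn !wsumS mulr_suml; apply: eq_bigr => x _.
by rewrite -mulrA -IHa.
Qed.

Lemma wsum_rev n F : wsum k n (F \o rev) = wsum k n F.
Proof.
have revK : involutive (fun w : n.-tuple 'I_k => [tuple of rev w]).
  by move=> w; apply: val_inj; rewrite /= revK.
rewrite /wsum [RHS](reindex_inj (inv_inj revK)) /=.
apply: eq_bigr => w _; rewrite map_rev; congr (q1 ^+ _ * _).
by apply: perm_big; rewrite perm_sym perm_rev.
Qed.

End WordSums.

(** Only words with positive letters contribute; lowering all [n] letters by one costs [q^n] and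
    shrinks the alphabet by one letter. *)
Lemma wsum_shift (k n : nat) (F : seq nat -> Qq) :
  (forall s, size s = n -> (0 \in s)%N -> F s = 0) ->
  wsum k.+1 n F = q1 ^+ n * wsum k n (F \o map succn).
Proof.
elim: n F => [|n IHn] F F0; first by rewrite !wsum0 mul1r.
rewrite !wsumS big_ord_recl /= [RHS]mulr_sumr.
rewrite (_ : wsum _ _ _ = 0); last first.
  rewrite -[RHS](mul0r (wsum k.+1 n (fun=> 0))) -wsumZ.
  by apply: eq_wsum => s sz_s; rewrite mul0r F0 //= ?sz_s // inE eqxx.
rewrite mulr0 add0r; apply: eq_bigr => a _.
rewrite IHn; last by move=> s sz_s s0; rewrite F0 //= ?sz_s // inE s0 orbT.
rewrite /bump /= add1n !mulrA; congr (_ * _); rewrite !exprS; ring.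
Qed.

(** * Runs in words *)

Section Runs.

Variables (e : rel nat) (m : nat).
Implicit Type s : seq nat.

(** The length of the longest prefix sorted by [e]; [runfree] need then only inspect the start of
    each suffix. *)
Fixpoint run s :=
  if s is x :: s' then
    (if s' is y :: _ then if e x y then run s' else 0%N else 0%N).+1
  else 0%N.

Fixpoint runfree s :=
  if s is _ :: s' then runfree s' && (run s < m)%N else true.

Lemma run_le_size s : (run s <= size s)%N.
Proof.
by elim: s => //= x [|y s] //= IHs; case: ifP => _ //; rewrite ltnS.
Qed.

Lemma sorted_take_run a s :
  (a <= size s)%N -> sorted e (take a s) = (a <= run s)%N.
Proof.
elim: s a => [|x s IHs] [|a] //=; rewrite ltnS => /IHs.
case: s {IHs} => [|y s]; first by case: a.
case: a => [|a] //=; rewrite ltnS.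
by case: (e x y); rewrite //= ltnS.
Qed.

Lemma runfreeE s : (0 < m)%N ->
  runfree s = ~~ has (fun i => sorted e (take m (drop i s)))
                     (iota 0 ((size s).+1 - m)).
Proof.
move=> m_gt0; elim: s => [|x s IHs]; first by case: m m_gt0.
have run_xs := run_le_size (x :: s).
case: (leqP m (size (x :: s))) => [le_ms|lt_sm]; last first.
  have -> : ((size (x :: s)).+1 - m = 0)%N by apply/eqP.
  have sm0 : ((size s).+1 - m = 0)%N by apply/eqP; exact: ltnW.
  rewrite /= -/(run (x :: s)) IHs sm0 /=.
  exact: leq_ltn_trans run_xs lt_sm.
rewrite (_ : (_ - m)%N = ((size s).+1 - m).+1); last by move: le_ms => /=; lia.
rewrite [iota _ _]/= -[1%N]/(1 + 0)%N iotaDl [has _ _]/= has_map.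
rewrite sorted_take_run // negb_or -ltnNge andbC.
by rewrite [LHS]/= IHs.
Qed.

(** The signs of the coefficients of B_k. *)
Definition chi (a : nat) : Qq := (a %% m == 0)%N%:R - (a %% m == 1)%N%:R.

(** The signed count of factorizations into a sorted prefix and a run-free suffix. The offset [i]
    stands for prefix letters already stripped off, as needed for induction on [s]. *)
Definition run_sum s (i : nat) : Qq :=
  \sum_(a < (size s).+1)
    chi (a + i) * (sorted e (take a s) && runfree (drop a s))%:R.

(** As [a] is 0 modulo [m] exactly when [a.+1] is 1, sums of [chi] over intervals telescope. *)
Lemma chi_telescope (a : nat) : (1 < m)%N ->
  chi a = (a.+1 %% m == 1)%N%:R - (a %% m == 1)%N%:R.
Proof.
move=> m_gt1; congr ((nat_of_bool _)%:R - _); apply/idP/idP => /eqP am;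
  apply/eqP.
  by rewrite -addn1 -modnDml am modn_small.
have lt_am : (a %% m < m)%N by rewrite ltn_mod; lia.
move: am; rewrite -addn1 -modnDml.
case: (ltngtP (a %% m + 1)%N m) => [lt_m|gt_m|->]; last by rewrite modnn.
  by rewrite modn_small //; lia.
lia.
Qed.

(** A nonempty sorted prefix of [x :: s] is [x] followed by a sorted prefix of [s], which must be
    empty when [e] fails between [x] and the next letter. *)
Lemma run_sum_cons x s i :
  run_sum (x :: s) i =
    chi i * (runfree (x :: s))%:R +
    (if s is y :: _ then
       if e x y then run_sum s i.+1 else chi i.+1 * (runfree s)%:R
     else run_sum s i.+1).
Proof.
rewrite /run_sum big_ord_recl take0 drop0 add0n; congr (_ + _).
have step (a : nat) : chi (bump 0 a + i) = chi (a + i.+1).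
  by rewrite /bump leq0n addnS addSn.
case: s => [|y s].
  by rewrite !big_ord1 /= step.
case exy: (e x y).
  apply: eq_bigr => -[a a_lt] _; rewrite step; congr (_ * _%:R).
  by case: a a_lt => [|a] a_lt //=; rewrite exy.
rewrite big_ord_recl [X in _ + X]big1 ?addr0 => [|a _].
  by rewrite step.
by rewrite /= exy mulr0.
Qed.

(* The indices [a] selected by [run_sum] form an interval.  If [s] contains a
   run of length [m], this interval is empty or consists of exactly [m]
   consecutive integers, over which [chi] sums to zero. *)
Lemma run_sumE s i : (1 < m)%N ->
  run_sum s i =
    (((i + (run s).+1) %% m == 1)%N%:R - (i %% m == 1)%N%:R) * (runfree s)%:R.
Proof.
move=> m_gt1; elim: s i => [|x s IHs] i.
  by rewrite /run_sum big_ord1 /= add0n chi_telescope // addn1.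
rewrite run_sum_cons; case: s IHs => [|y s] IHs.
  rewrite IHs /= m_gt1 !chi_telescope // !addn2 !addn1.
  by rewrite !mulr1 addrC addrA subrK.
case exy: (e x y).
  rewrite IHs [run (x :: _)]/= exy [runfree (x :: _)]/= exy
    -/(runfree (y :: s)).
  rewrite -/(run (y :: s)).
  case free: (runfree (y :: s)); last by rewrite /= !mulr0 addr0.
  rewrite /= -/(run (y :: s)).
  have run_lt : (run (y :: s) < m)%N by move: free => /= /andP[].
  case: ltnP => [lt_m|ge_m].
    by rewrite chi_telescope // !addnS addSn !mulr1 addrC addrA subrK.
  (* The new letter completes a run of exactly [m], since the run of [y :: s] is shorter than [m];
     the two indicators then agree modulo [m] and cancel. *)
  have -> : (run (y :: s)).+1 = m by lia.
  by rewrite addnC modnDl subrr !mulr0 mul0r addr0.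
rewrite [runfree (x :: _)]/= exy m_gt1 andbT -/(runfree (y :: s))
  [run (x :: _)]/= exy.
by rewrite !chi_telescope // addn2 -mulrDl addrC addrA subrK.
Qed.

(** A nonempty run-free word has [1 <= run s < m], so [(run s).+1] lies between 2 and [m] and is
    never 1 modulo [m]. *)
Lemma run_sum0 s : (1 < m)%N -> run_sum s 0 = (size s == 0)%N%:R.
Proof.
move=> m_gt1; rewrite run_sumE //.
case: s => [|x s]; first by rewrite /= modn_small // mod0n subr0 mulr1.
rewrite mod0n subr0 add0n.
case free: (runfree _); last by rewrite mulr0.
have run_lt : (run (x :: s) < m)%N by move: free => /= /andP[].
rewrite mulr1 [RHS]/=; case: eqP => //.
have : (0 < run (x :: s))%N by [].
move: (run _) run_lt => r lt_rm r_gt0.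
case: (ltngtP r.+1 m) => [lt_m|gt_m|->]; last by rewrite modnn.
  by rewrite modn_small //; lia.
lia.
Qed.

Definition wsum_runfree (k n : nat) : Qq := wsum k n (fun s => (runfree s)%:R).
Definition wsum_sorted (k n : nat) : Qq := wsum k n (fun s => (sorted e s)%:R).

(** Summing [run_sum] over all words gives, coefficient by coefficient, that B_k times the series of
    run-free words is 1. *)
Lemma wsum_runfree_sorted k n : (1 < m)%N ->
  \sum_(a < n.+1) chi a * (wsum_sorted k a * wsum_runfree k (n - a)) =
  (n == 0)%N%:R.
Proof.
move=> m_gt1.
transitivity (wsum k n (run_sum^~ 0%N)).
  transitivity (wsum k n (fun s => \sum_(a < n.+1)
      chi a * (sorted e (take a s) && runfree (drop a s))%:R)).
    rewrite wsum_sum; apply: eq_bigr => a _.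
    rewrite wsumZ -wsum_cat subnKC ?leq_ord //; congr (_ * _).
    by apply: eq_wsum => s _; rewrite -natrM mulnb.
  apply: eq_wsum => s <-.
  by apply: eq_bigr => a _; rewrite addn0.
case: n => [|n]; first by rewrite wsum0 run_sum0.
rewrite -[RHS](mul0r (wsum k n.+1 (fun=> 0))) -wsumZ.
by apply: eq_wsum => s sz_s; rewrite run_sum0 // sz_s mul0r.
Qed.

End Runs.

(** * P-partitions of a labelled chain *)

(** Appending at the end leaves earlier descent positions unchanged; this is why labels are consumed
    from the last position backwards. *)
Lemma descents_rcons s x y :
  descents (rcons (rcons s y) x) =
  descents (rcons s y) ++ (if (x < y)%N then [:: (size s).+1] else [::]).
Proof.
rewrite /descents !size_rcons !succnK.
have -> : iota 1 (size s).+1 = iota 1 (size s) ++ [:: (size s).+1].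
  by rewrite -[(size s).+1]addn1 iotaD add1n addn1.
rewrite filter_cat.
congr (_ ++ _); last first.
  by rewrite /= !nth_rcons !size_rcons ltnn eqxx leqnn ltnn eqxx.
apply: eq_in_filter => i; rewrite mem_iota => /andP[i_gt0 i_lt].
rewrite ![nth 0%N (rcons _ x) _]nth_rcons size_rcons.
have [i_le i1_le] : (i < (size s).+1)%N /\ (i.-1 < (size s).+1)%N by lia.
by rewrite i_le i1_le.
Qed.

(* The letters [z_j] are labels and the [g_j] values, read from the last
   position to the first: reversing both gives a weakly decreasing sequence of
   values, strictly decreasing at the descents of the labels. *)
Definition lex_step (p p' : nat * nat) : bool :=
  (p.1 + (p.2 <= p'.2) <= p'.1)%N.

Definition ppart (z g : seq nat) : bool := sorted lex_step (zip g z).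

Definition wsum_ppart (k : nat) (z : seq nat) : Qq :=
  wsum k (size z) (fun g => (ppart z g)%:R).

Lemma ppart_leq z g : size g = size z -> ppart z g -> sorted leq g.
Proof.
move=> sz_g; rewrite /ppart -[in sorted leq g](unzip1_zip (eq_leq sz_g))
  sorted_map.
by apply: sub_sorted => p p' /=; rewrite /lex_step; lia.
Qed.

Lemma ppart_succ z g : ppart z (map succn g) = ppart z g.
Proof.
rewrite /ppart -[z in LHS](map_id z) -/(zip _ _).
have -> : zip (map succn g) (map id z) = [seq (p.1.+1, p.2) | p <- zip g z].
  by elim: g z => [|x g IHg] [|y z] //=; rewrite IHg.
by rewrite sorted_map.
Qed.

Lemma ppart_gt0 x z a g :
  size g = size z -> ppart (x :: z) (a.+1 :: g) -> 0%N \notin g.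
Proof.
move=> sz_g; have sz_ag : size (a.+1 :: g) = size (x :: z) by rewrite /= sz_g.
move=> /(ppart_leq sz_ag) /=.
rewrite (path_sortedE leq_trans) => /andP[/allP g_gt0 _].
by apply/negP => /g_gt0.
Qed.

Lemma ppart_cons x y z b g :
  ppart (x :: y :: z) (0%N :: b :: g) =
  ((x <= y)%N <= b)%N && ppart (y :: z) (b :: g).
Proof. by []. Qed.

Lemma wsum_ppart_0 x z : wsum_ppart 0 (x :: z) = 0.
Proof. by rewrite /wsum_ppart wsumS big_ord0. Qed.

(** The first value is the smallest: if it is positive, all values can be lowered by one; the second
    summand covers first value 0. *)
Lemma wsum_ppartS k x z :
  wsum_ppart k.+1 (x :: z) =
  q1 ^+ (size z).+1 * wsum_ppart k (x :: z) +
  wsum k.+1 (size z) (fun g => (ppart (x :: z) (0%N :: g))%:R).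
Proof.
rewrite /wsum_ppart -[size (x :: z)]/(size z).+1.
rewrite [LHS]wsumS big_ord_recl mul1r addrC; congr (_ + _).
rewrite wsumS [RHS]mulr_sumr; apply: eq_bigr => a _.
rewrite wsum_shift; last first.
  move=> g sz_g g0; case: (boolP (ppart _ _)) => // /(ppart_gt0 sz_g).
  by rewrite g0.
rewrite lift0.
have -> : wsum k (size z)
            ((fun g => (ppart (x :: z) (a.+1 :: g))%:R) \o map succn) =
          wsum k (size z) (fun g => (ppart (x :: z) (val a :: g))%:R).
  by apply: eq_wsum => g _; rewrite /= -[_.+1 :: _]/(map succn (val a :: g))
    ppart_succ.
rewrite !exprS; ring.
Qed.

Lemma wsum_ppart1 k x :
  wsum_ppart k.+1 [:: x] = q1 * wsum_ppart k [:: x] + 1.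
Proof. by rewrite wsum_ppartS wsum0. Qed.

(** After a first value 0, [x <= y] forces the next value, hence the whole tail, to be positive, and
    the tail can be lowered by one; otherwise 0 imposes nothing on it. *)
Lemma wsum_ppart_cons k x y z :
  wsum_ppart k.+1 (x :: y :: z) =
  q1 ^+ (size z).+2 * wsum_ppart k (x :: y :: z) +
  (if (x <= y)%N then q1 ^+ (size z).+1 * wsum_ppart k (y :: z)
   else wsum_ppart k.+1 (y :: z)).
Proof.
rewrite wsum_ppartS; congr (_ + _); case: ifP => le_xy; last first.
  by apply: eq_wsum => -[|b g] // _; rewrite ppart_cons le_xy.
rewrite wsum_shift => [|[|b g] // [sz_g]].
  congr (_ * _); apply: eq_wsum => -[|b g] // _.
  by rewrite /= ppart_cons le_xy -[_.+1 :: _]/(map succn (b :: g)) ppart_succ.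
rewrite ppart_cons le_xy inE; case: b => [|b] //= g0.
by case: (boolP (ppart _ _)) => // /(ppart_gt0 sz_g); rewrite g0.
Qed.

(** * MacMahon's generating function in t *)

Definition tseries (P : nat -> Qq) : Qqxt := \fps_(k) fpsC (P k).

Definition qden (n : nat) : Qqxt := \prod_(i < n.+1) (1 - t3 * q3 ^+ i).

Lemma q3X n : q3 ^+ n = fpsC (fpsC (q1 ^+ n)).
Proof. by rewrite -!fpsCX. Qed.

Lemma coef0_tq_factor P n :
  [coef 0] ((1 - t3 * q3 ^+ n) * tseries P) = fpsC (P 0%N).
Proof.
by rewrite mulrBl mul1r -mulrA coef_fpsB coef0_fpsXM subr0.
Qed.

Lemma coefS_tq_factor P n k :
  [coef k.+1] ((1 - t3 * q3 ^+ n) * tseries P) =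
  fpsC (P k.+1 - q1 ^+ n * P k).
Proof.
rewrite mulrBl mul1r -mulrA coef_fpsB coefS_fpsXM q3X coef_fpsCM.
by rewrite fpsCD fpsCN fpsCM.
Qed.

Lemma one_subt_tseries : (1 - t3) * tseries (fun=> 1) = 1.
Proof.
have -> : 1 - t3 = 1 - t3 * q3 ^+ 0 by rewrite expr0 mulr1.
apply/fpsP => -[|k]; first by rewrite coef0_tq_factor coef_fps1.
by rewrite coefS_tq_factor mul1r subrr fpsC0 coef_fps1.
Qed.

Lemma qdenS n : qden n.+1 = (1 - t3 * q3 ^+ n.+1) * qden n.
Proof. by rewrite /qden big_ord_recr [LHS]mulrC. Qed.

Lemma qden0 : qden 0 = 1 - t3.
Proof. by rewrite /qden big_ord1 expr0 mulr1. Qed.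

(** Induction on [z], whose head is the last letter of [rev z]: each letter adds a factor to the
    denominator and, when it creates a descent, a factor to the numerator. *)
Lemma macmahon_ppart z : uniq z -> (0 < size z)%N ->
  qden (size z) * tseries (wsum_ppart^~ z) =
  t3 ^+ (size (descents (rev z))).+1 * q3 ^+ sumn (descents (rev z)).
Proof.
case: z => // x z; elim: z x => [|y z IHz] x.
  move=> _ _; have -> : descents (rev [:: x]) = [::] by [].
  rewrite -[size [:: x]]/1%N -[size [::]]/0%N -[sumn [::]]/0%N.
  rewrite [q3 ^+ 0]expr0 [RHS]mulr1 [t3 ^+ 1]expr1 qdenS qden0 mulrAC.
  rewrite [LHS]mulrC.
  have -> : (1 - t3 * q3 ^+ 1) * tseries (wsum_ppart^~ [:: x]) =
            t3 * tseries (fun=> 1).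
    apply/fpsP => -[|k].
      by rewrite coef0_tq_factor wsum_ppart_0 coef0_fpsXM fpsC0.
    by rewrite coefS_tq_factor wsum_ppart1 coefS_fpsXM addrC addKr.
  by rewrite mulrCA one_subt_tseries mulr1.
move=> /= /andP[]; rewrite inE negb_or => /andP[neq_xy _] uniq_yz _.
rewrite qdenS mulrAC mulrC.
(* The new denominator factor cancels the first term of [wsum_ppart_cons]. Labels being distinct,
   [x <= y] means [x < y], a descent of the reversed list at position [(size z).+1]. *)
have -> : (1 - t3 * q3 ^+ (size z).+2) * tseries (wsum_ppart^~ [:: x, y & z]) =
          (if (x < y)%N then t3 * q3 ^+ (size z).+1 else 1) *
          tseries (wsum_ppart^~ (y :: z)).
  apply/fpsP => -[|k].
    rewrite coef0_tq_factor wsum_ppart_0; case: ifP => _.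
      by rewrite -mulrA coef0_fpsXM fpsC0.
    by rewrite mul1r /= wsum_ppart_0.
  rewrite coefS_tq_factor wsum_ppart_cons addrC addKr leq_eqVlt (negPf neq_xy)
    orFb.
  case: ifP => _; last by rewrite mul1r.
  by rewrite -mulrA coefS_fpsXM q3X coef_fpsCM fpsCM.
rewrite mulrCA [qden _ * _](IHz y) //.
rewrite !rev_cons descents_rcons size_rev -!rev_cons.
case: ifP => _; last by rewrite mul1r cats0.
rewrite size_cat sumn_cat addn1 [sumn [:: _]]addn0 [t3 ^+ _.+2]exprS.
rewrite [q3 ^+ (_ + _)]exprD.
ring.
Qed.

(** * Standardization of words *)

Lemma std_sorted s : sorted ltn s -> std s = iota 1 (size s).
Proof.
elim: s => //= x s IHs; rewrite (path_sortedE ltn_trans) => /andP[/allP x_lt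
  /IHs std_s].
rewrite /std /= leqnn; congr cons.
  have -> : count (leq^~ x) s = 0%N; last by [].
  by apply/eqP; rewrite -leqn0 leqNgt -has_count; apply/hasPn => y /x_lt /=;
    rewrite -ltnNge.
rewrite -[2%N]/(1 + 1)%N iotaDl -std_s /std -map_comp.
apply/eq_in_map => y /x_lt /= lt_xy.
by rewrite (ltnW lt_xy).
Qed.

Lemma std_iota s : (std s == iota 1 (size s)) = sorted ltn s.
Proof.
apply/eqP/idP => [std_s|/std_sorted//]; apply/(sortedP 0%N) => i i_lt.
have nth_std (j : nat) : (j < size s)%N ->
    count (fun b => (b <= nth 0 s j)%N) s = j.+1.
  move=> j_lt; have := congr1 (fun t => nth 0%N t j) std_s.
  by rewrite nth_iota // (nth_map 0%N).
rewrite /= ltnNge; apply/negP => le_s.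
(* A non-ascent at [i] would keep the rank from growing, but the ranks there are [i.+1] and
   [i.+2]. *)
have : (count (fun b => (b <= nth 0 s i.+1)%N) s <=
        count (fun b => (b <= nth 0 s i)%N) s)%N.
  by apply: sub_count => b /= /leq_trans; apply.
by rewrite (nth_std _ i_lt) (nth_std _ (ltnW i_lt)) ltnn.
Qed.

Lemma oneline_incr_perm m : oneline (incr_perm m) = iota 1 m.
Proof.
rewrite /oneline -[1%N]/(1 + 0)%N iotaDl -val_enum_ord -map_comp.
by apply: eq_map => i /=; rewrite perm1.
Qed.

Lemma size_oneline n (s : 'S_n) : size (oneline s) = n.
Proof. by rewrite size_map size_enum_ord. Qed.

Lemma avoids_incrE n m (s : 'S_n) :
  avoids s (incr_perm m) =
  ~~ has (fun i => sorted ltn (take m (drop i (oneline s))))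
         (iota 0 (n.+1 - m)).
Proof.
rewrite /avoids oneline_incr_perm; congr (~~ _); apply: eq_in_has => i.
rewrite mem_iota add0n => /andP[_ i_lt].
rewrite -std_iota size_takel // size_drop size_oneline; lia.
Qed.

Section Standardization.

Variables (k n : nat).
Implicit Types (w : n.-tuple 'I_k) (s : 'S_n) (i j : 'I_n).

(* [j <= i] is coerced to 0 or 1: either [w_i > w_j], or [w_i = w_j] and
   [i < j]. *)
Definition std_before w i j : bool := (tnth w j + (j <= i) <= tnth w i)%N.

Definition standardizes s w : bool :=
  [forall i, forall j, (s i < s j)%N == std_before w i j].

Lemma std_before_irr w : irreflexive (std_before w).
Proof. by move=> i; rewrite /std_before leqnn addn1 ltnn. Qed.

Lemma std_before_trans w : transitive (std_before w).
Proof. by move=> j i l; rewrite /std_before; lia. Qed.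

Lemma std_before_total w i j : i != j -> std_before w i j = ~~ std_before w j i.
Proof. by rewrite -val_eqE /std_before; case: (ltngtP i j); lia. Qed.

Definition std_rank w i : nat := #|[set j | std_before w j i]|.

Lemma std_rank_lt w i : (std_rank w i < n)%N.
Proof.
rewrite -[X in (_ < X)%N]card_ord -cardsT; apply: proper_card.
rewrite properT; apply/negP => /eqP/setP/(_ i).
by rewrite !inE std_before_irr.
Qed.

Definition std_fun w i : 'I_n := Ordinal (std_rank_lt w i).

Lemma std_rank_mono w i j : std_before w i j -> (std_rank w i < std_rank w j)%N.
Proof.
move=> ij; apply: proper_card; apply/properP; split.
  by apply/subsetP => l; rewrite !inE => /std_before_trans; apply.
by exists i; rewrite inE // std_before_irr.
Qed.

Lemma std_rankE w i j : (std_rank w i < std_rank w j)%N = std_before w i j.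
Proof.
have [->|neq_ij] := eqVneq i j; first by rewrite ltnn std_before_irr.
case: (boolP (std_before w i j)) => [/std_rank_mono//|].
rewrite std_before_total // negbK => /std_rank_mono; lia.
Qed.

Lemma std_fun_inj w : injective (std_fun w).
Proof.
move=> i j /(congr1 val) /= eq_ij; apply/eqP; apply: contraT => neq_ij.
have := std_before_total w neq_ij.
by rewrite -!std_rankE eq_ij ltnn.
Qed.

Definition std_perm w : 'S_n := perm (@std_fun_inj w).

(** A permutation is determined by the order of its values, as [s i] counts the [j] with
    [s j < s i]. Hence each word has exactly one standardization. *)
Lemma standardizesE s w : standardizes s w = (s == std_perm w).
Proof.
apply/idP/eqP => [/forallP s_w|->]; last first.
  by apply/forallP => i; apply/forallP => j; rewrite !permE /= std_rankE.
apply/permP => i; apply: val_inj; rewrite permE /= /std_rank.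
have -> : [set j | std_before w j i] = [set j | (s j < s i)%N].
  by apply/setP => j; rewrite !inE; have /forallP/(_ i)/eqP-> := s_w j.
rewrite -(card_imset _ (@perm_inj _ s)).
have -> : [set s j | j in [set j | (s j < s i)%N]] =
          [set l : 'I_n | (l < s i)%N].
  apply/setP => l; rewrite inE; apply/imsetP/idP => [[j]|lt_l].
    by rewrite inE => lt_ji ->.
  by exists (s^-1 l)%g; rewrite ?inE permKV.
rewrite -sum1dep_card -[LHS]card_ord -sum1_card.
rewrite (big_ord_widen n (fun=> 1%N)) //; exact: ltnW.
Qed.

(** By transitivity it suffices to compare positions with consecutive values of [s], which gives a
    chain condition of the same shape as [ppart]. *)
Lemma standardizes_sorted s w :
  standardizes s w = sorted (std_before w) [seq s^-1%g i | i <- enum 'I_n].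
Proof.
rewrite sorted_pairwise; last exact: std_before_trans.
apply/idP/idP => [/forallP s_w|].
  rewrite pairwise_map; apply: (@sub_pairwise _ (relpre val ltn)).
    move=> i j /= lt_ij; have /forallP/(_ (s^-1 j)%g)/eqP := s_w (s^-1 i)%g.
    by rewrite !permKV lt_ij => <-.
  by rewrite -pairwise_map val_enum_ord -(sorted_pairwise ltn_trans)
    iota_ltn_sorted.
rewrite pairwise_map => pw.
have before_inv i j : (i < j)%N -> std_before w (s^-1 i)%g (s^-1 j)%g.
  move=> lt_ij; have := pairwiseP i pw i j.
  by rewrite !inE size_enum_ord !ltn_ord !nth_ord_enum; apply.
apply/forallP => i; apply/forallP => j; apply/eqP.
rewrite -[i in RHS](permK s) -[j in RHS](permK s).
case: (ltngtP (s i) (s j)) => [/before_inv->//|lt_ji|/val_inj->].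
  have := before_inv _ _ lt_ji; rewrite !permK; case: (eqVneq i j) => [->|].
    by rewrite std_before_irr.
  by move=> neq_ij; rewrite (std_before_total _ neq_ij) => ->.
by rewrite std_before_irr.
Qed.

Lemma avoids_standardizes m s w : (0 < m)%N -> standardizes s w ->
  avoids s (incr_perm m) = runfree geq m [seq val a | a <- w].
Proof.
move=> m_gt0 /forallP s_w; rewrite avoids_incrE runfreeE // size_map size_tuple.
congr (~~ _); apply: eq_has => i.
have -> : [seq val a | a <- w] = [seq val (tnth w a) | a <- enum 'I_n].
  by rewrite -[in LHS](map_tnth_enum w) -map_comp.
have := iota_ltn_sorted 0 n; rewrite -val_enum_ord sorted_map /oneline.
move: (enum 'I_n) => u u_lt; rewrite -!map_drop -!map_take !sorted_map.
have t_lt : sorted (relpre val ltn) (take m (drop i u)).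
  by apply: take_sorted; apply: drop_sorted.
move: (take m _) t_lt => t t_lt.
(* Positions in a window increase, and for [a < b] the relation [std_before w a b] is just
   [w_a >= w_b]. *)
have restrict (e : rel 'I_n) :
    sorted e t = sorted [rel a b | e a b && (a < b)%N] t.
  by rewrite sorted_relI t_lt andbT.
rewrite [LHS]restrict [RHS]restrict; apply: eq_sorted => a b /=.
rewrite ltnS; have /forallP/(_ b)/eqP-> := s_w a.
by rewrite /std_before; case: ltnP; rewrite ?andbF ?andbT ?addn0.
Qed.

(** Reading [w] at the positions [s^-1 0], [s^-1 1], ... is a weight-preserving bijection on words;
    under it [lex_step], read backwards, becomes [std_before]. *)
Lemma wsum_ppart_standardizes s :
  wsum_ppart k (rev (oneline s^-1%g)) =
  \sum_(w : n.-tuple 'I_k | standardizes s w) q1 ^+ (\sum_(a <- w) a).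
Proof.
pose relabel (r : 'S_n) w := [tuple tnth w (r i) | i < n].
have relabelK r : cancel (relabel r) (relabel r^-1%g).
  by move=> w; apply: eq_from_tnth => i; rewrite !tnth_mktuple permKV.
have relabelVK r : cancel (relabel r^-1%g) (relabel r).
  by move=> w; apply: eq_from_tnth => i; rewrite !tnth_mktuple permK.
rewrite /wsum_ppart size_rev size_oneline -wsum_rev /wsum [LHS](reindex
  (relabel s^-1%g)); last first.
  by apply: onW_bij; exists (relabel s).
rewrite [RHS]big_mkcond; apply: eq_bigr => w _.
have -> : \sum_(a <- relabel s^-1%g w) (a : nat) = \sum_(a <- w) (a : nat).
  rewrite !big_tuple [RHS](reindex_inj (@perm_inj _ s^-1%g)).
  by apply: eq_bigr => i _; rewrite tnth_mktuple.
rewrite [(_ \o rev) _]/=.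
suff -> : ppart (rev (oneline s^-1%g))
                (rev [seq val a | a <- relabel s^-1%g w]) =
          standardizes s w by case: ifP; rewrite ?mulr1 ?mulr0.
rewrite standardizes_sorted /ppart -rev_zip ?rev_sorted; last first.
  by rewrite size_oneline size_map size_tuple.
rewrite /oneline /relabel /= -map_comp zip_map !sorted_map.
by apply: eq_sorted => a b.
Qed.

(** The words are partitioned by their standardizations, and avoidance by the latter is run-freeness
    of the word. *)
Lemma sum_avoids_wsum_ppart m : (0 < m)%N ->
  \sum_(s : 'S_n | avoids s (incr_perm m)) wsum_ppart k (rev (oneline s^-1%g)) =
  wsum_runfree geq m k n.
Proof.
move=> m_gt0; under eq_bigr do rewrite wsum_ppart_standardizes.
rewrite (exchange_big_dep predT) //=; apply: eq_bigr => w _.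
rewrite (eq_bigl (fun s =>
  (s == std_perm w) && runfree geq m [seq val a | a <- w])).
  by rewrite big_mkcondr big_pred1_eq; case: ifP; rewrite ?mulr1 ?mulr0.
move=> s; rewrite andbC standardizesE; case: eqP => //= ->.
by apply: avoids_standardizes; rewrite ?standardizesE.
Qed.

End Standardization.

(** * Weakly decreasing words *)

Lemma wsum_ppart_iota k a :
  wsum_ppart k (rev (iota 0 a)) = wsum_sorted geq k a.
Proof.
rewrite /wsum_ppart /wsum_sorted size_rev size_iota -[RHS]wsum_rev.
apply: eq_wsum => g sz_g; rewrite [(_ \o rev) _]/= rev_sorted;
  congr (nat_of_bool _)%:R.
have sz_z : size g = size (rev (iota 0 a)) by rewrite size_rev size_iota.
(* The labels strictly decrease along the list, so the 0-or-1 correction in [lex_step] is always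
   0. *)
have gt_z : sorted (relpre (@snd nat nat) gtn) (zip g (rev (iota 0 a))).
  by rewrite -sorted_map -/unzip2 unzip2_zip ?sz_z // rev_sorted
    iota_ltn_sorted.
rewrite -[g in RHS](unzip1_zip (eq_leq sz_z)) /ppart sorted_map.
rewrite -[LHS]andbT -[RHS]andbT -{1 2}gt_z -!sorted_relI.
by apply: eq_sorted => p p' /=; rewrite /lex_step; lia.
Qed.

Lemma wsum_sorted0 k : wsum_sorted geq k 0 = 1.
Proof. by rewrite /wsum_sorted wsum0. Qed.

Lemma wsum_sorted_0S a : wsum_sorted geq 0 a.+1 = 0.
Proof. by rewrite /wsum_sorted wsumS big_ord0. Qed.

(** The q-Pascal rule, as the descent-free case of the P-partition recurrence. *)
Lemma wsum_sortedSS k a :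
  wsum_sorted geq k.+1 a.+1 =
  q1 ^+ a.+1 * wsum_sorted geq k a.+1 + wsum_sorted geq k.+1 a.
Proof.
case: a => [|a]; first by rewrite wsum_sorted0 -!wsum_ppart_iota wsum_ppart1
  expr1.
have rev_iotaS b : rev (iota 0 b.+1) = b :: rev (iota 0 b).
  by rewrite -[b.+1]addn1 iotaD rev_cat.
rewrite -!wsum_ppart_iota !rev_iotaS wsum_ppart_cons ltnn.
by rewrite size_rev size_iota.
Qed.

Lemma macmahon_sorted n : (0 < n)%N ->
  qden n * tseries (fun k => wsum_sorted geq k n) = t3.
Proof.
move=> n_gt0; have := @macmahon_ppart (rev (iota 0 n)).
rewrite rev_uniq iota_uniq size_rev size_iota revK => /(_ isT n_gt0).
have -> : descents (iota 0 n) = [::].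
  rewrite /descents; apply/eqP; rewrite -[_ == _]negbK -has_filter;
    apply/hasPn => i.
  rewrite mem_iota size_iota => i_lt; rewrite !nth_iota; lia.
rewrite [q3 ^+ _]expr0 mulr1 expr1 => <-; congr (_ * _).
by apply/fpsP => k; rewrite [RHS]/= wsum_ppart_iota.
Qed.

(** * q-factorials and q-binomial coefficients *)

Definition qint (n : nat) : Qq := \sum_(i < n) q1 ^+ i.

Lemma qintD a b : qint (a + b) = qint a + q1 ^+ a * qint b.
Proof.
rewrite /qint big_split_ord /= mulr_sumr; congr (_ + _).
by apply: eq_bigr => i _; rewrite exprD.
Qed.

Lemma qfactS n : qfact n.+1 = qfact n * qint n.+1.
Proof. by rewrite /qfact big_nat_recr. Qed.

Lemma unit_fpsE (R : comUnitRingType) (f : fps R) :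
  (f \is a GRing.unit) = ([coef 0] f \is a GRing.unit).
Proof. by []. Qed.

Lemma qfact_unit n : qfact n \is a GRing.unit.
Proof.
elim: n => [|n IHn]; first by rewrite /qfact big_geq ?unitr1.
rewrite qfactS unitrM IHn unit_fpsE.
rewrite /qint big_ord_recl coef_fpsD coef_fps_sum big1 => [|i _]; last first.
  by rewrite lift0 exprS coef0_fpsXM.
by rewrite addr0 coef_fps1 unitr1.
Qed.

(** The q-binomial formula without division, by double induction along the q-Pascal rule; [qintD]
    recombines the two summands. *)
Lemma wsum_sorted_qfact k a :
  wsum_sorted geq k.+1 a * (qfact k * qfact a) = qfact (k + a).
Proof.
have qfact0 : qfact 0 = 1 by rewrite /qfact big_geq.
elim: a k => [|a IHa] k; first by rewrite wsum_sorted0 qfact0 !mulr1 mul1r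
  addn0.
elim: k => [|k IHk]; rewrite wsum_sortedSS.
  rewrite wsum_sorted_0S mulr0 add0r qfactS mulrA [_ * qint _]mulrC.
  by rewrite mulrCA -[_ * _ * _]mulrA IHa add0n mulrC -qfactS.
rewrite mulrDl.
transitivity (q1 ^+ a.+1 * qint k.+1 * qfact (k + a.+1) +
              qint a.+1 * qfact (k.+1 + a)).
  by rewrite -IHk -IHa !qfactS; ring.
rewrite addSnnS addSn [RHS]qfactS -addSn [(k.+1 + _)%N]addnC qintD; ring.
Qed.

Lemma qbinomE k a : qbinom (k + a) k = wsum_sorted geq k.+1 a.
Proof.
by rewrite /qbinom addKn -wsum_sorted_qfact mulrK // unitrM !qfact_unit.
Qed.

(** * Generating functions *)

Lemma qden_unit n : qden n \is a GRing.unit.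
Proof.
have coef0_qden : [coef 0] (qden n) = 1.
  rewrite coef0_prod big1 // => i _.
  by rewrite coef_fpsB coef0_fpsXM subr0 coef_fps1.
by rewrite unit_fpsE coef0_qden unitr1.
Qed.

Lemma tseries_sum (I : Type) (r : seq I) (P : pred I) (F : I -> nat -> Qq) :
  \sum_(i <- r | P i) tseries (F i) =
  tseries (fun k => \sum_(i <- r | P i) F i k).
Proof.
by apply/fpsP => k; rewrite coef_fps_sum [RHS]/= fpsC_sum.
Qed.

Lemma coef_x3XM n f c : [coef c] (x3 ^+ n * f) = x2 ^+ n * [coef c] f.
Proof. by rewrite -fpsCX coef_fpsCM. Qed.

Lemma coef_fpsC_x2X (p : Qq) n b :
  [coef b] (fpsC p * x2 ^+ n) = p * (b == n)%:R.
Proof. by rewrite coef_fpsCM coef_fpsXn. Qed.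

Lemma A_ides_imajE m n : (0 < m)%N ->
  A_ides_imaj (incr_perm m) n / qden n =
  tseries (fun k => wsum_runfree geq m k n).
Proof.
move=> m_gt0; rewrite /A_ides_imaj; case: posnP => [->|n_gt0].
  (* For [n = 0] the numerator is 1 rather than a multiple of t: the empty word exists even over the
     empty alphabet. *)
  have -> : tseries (fun k => wsum_runfree geq m k 0) = tseries (fun=> 1).
    by apply/fpsP => k; rewrite /= /wsum_runfree wsum0.
  apply: (mulIr (qden_unit 0)); rewrite divrK ?qden_unit //.
  by rewrite mulrC qden0 one_subt_tseries.
apply: (mulIr (qden_unit n)); rewrite divrK ?qden_unit // mulrC.
transitivity (qden n * \sum_(s : 'S_n | avoids s (incr_perm m))
                 tseries (fun k => wsum_ppart k (rev (oneline s^-1%g)))).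
  rewrite mulr_sumr; apply: eq_bigr => s _.
  have := @macmahon_ppart (rev (oneline s^-1%g)).
  rewrite size_rev size_oneline rev_uniq revK => -> //.
  by rewrite map_inj_uniq ?enum_uniq // => i j [/val_inj/perm_inj].
congr (_ * _); rewrite tseries_sum; apply/fpsP => k.
by rewrite [LHS]/= sum_avoids_wsum_ppart.
Qed.

Lemma mul_t3_qdenV n : (0 < n)%N ->
  t3 / qden n = tseries (fun k => wsum_sorted geq k n).
Proof.
by move=> n_gt0; rewrite -(macmahon_sorted n_gt0) mulrC mulKr ?qden_unit.
Qed.

Lemma coef_t3x3_qden n c : (0 < n)%N ->
  [coef c] (t3 * x3 ^+ n / qden n) = fpsC (wsum_sorted geq c n) * x2 ^+ n.
Proof.
by move=> n_gt0; rewrite mulrAC mulrC coef_x3XM mul_t3_qdenV // mulrC.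
Qed.

(** * Convergence and evaluation of the series *)

Section Main.

Variable m : nat.
Hypothesis m_gt1 : (1 < m)%N.

Let m_gt0 : (0 < m)%N := ltnW m_gt1.

Definition sorted_gf (k : nat) : Qqx :=
  \fps_(n) (chi m n * wsum_sorted geq k n).
Definition runfree_gf (k : nat) : Qqx := \fps_(n) (wsum_runfree geq m k n).

Lemma sorted_gf_runfree_gf k : sorted_gf k * runfree_gf k = 1.
Proof.
apply/fpsP => n; rewrite coef_fps1 -(wsum_runfree_sorted geq k n m_gt1).
by rewrite coef_fpsM; apply: eq_bigr => a _; rewrite [RHS]mulrA.
Qed.

Lemma sum_eq_mod (r b N : nat) : (r < m)%N -> (b < N)%N ->
  \sum_(j < N) (b == j * m + r)%N%:R = (b %% m == r)%N%:R :> Qq.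
Proof.
move=> r_lt b_lt; have q_lt : (b %/ m < N)%N by apply: leq_ltn_trans b_lt;
  apply: leq_div.
rewrite (bigD1 (Ordinal q_lt)) //= big1 ?addr0 => [|j neq_j].
  by rewrite {1}(divn_eq b m) eqn_add2l.
case: eqP => // b_eq; case/negP: neq_j; rewrite -val_eqE /= b_eq.
by rewrite divnMDl // divn_small // addn0.
Qed.

(** A block containing [x^b] has index at most [b], so [b < N] blocks already give the final
    coefficient. *)
Lemma coef_sum_chi (g : nat -> Qq) (b N : nat) : (b < N)%N ->
  [coef b] (\sum_(j < N) (fpsC (g (j * m)%N) * x2 ^+ (j * m)
                          - fpsC (g (j * m + 1)%N) * x2 ^+ (j * m + 1))) =
  chi m b * g b.
Proof.
move=> b_lt; rewrite coef_fps_sum.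
transitivity
  (\sum_(j < N) ((b == j * m + 0)%N%:R - (b == j * m + 1)%N%:R) * g b).
  apply: eq_bigr => j _; rewrite coef_fpsB !coef_fpsC_x2X addn0 mulrBl.
  by congr (_ - _); case: eqP => [<-|]; rewrite ?mulr1 ?mul1r // mulr0 mul0r.
by rewrite -mulr_suml big_split sumrN /= !sum_eq_mod.
Qed.

Lemma wsum_sorted_x0 c :
  fpsC (wsum_sorted geq c 0) * x2 ^+ 0 = 1.
Proof. by rewrite wsum_sorted0 mul1r. Qed.

Definition sorted_gf_term (c j : nat) : Qqx :=
  fpsC (wsum_sorted geq c (j * m)%N) * x2 ^+ (j * m)
  - fpsC (wsum_sorted geq c (j * m + 1)%N) * x2 ^+ (j * m + 1).

Lemma sorted_gf_term0 c :
  sorted_gf_term c 0 = 1 - fpsC (wsum_sorted geq c 1) * x2.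
Proof. by rewrite /sorted_gf_term mul0n add0n wsum_sorted_x0. Qed.

Lemma sums_to2_sorted_gf c : sums_to2 (sorted_gf_term c) (sorted_gf c).
Proof.
by move=> a b; exists b.+1 => n b_lt; rewrite coef_sum_chi.
Qed.

Lemma bracket_termE k j :
  fpsC (qbinom (k.+1 + j * m - 1) (k.+1 - 1)) * x2 ^+ (j * m)
  - fpsC (qbinom (k.+1 + j * m) (k.+1 - 1)) * x2 ^+ (j * m + 1) =
    sorted_gf_term k.+1 j.
Proof.
have top0 : (k.+1 + j * m - 1 = k + j * m)%N by rewrite addSn subn1.
have top1 : (k.+1 + j * m = k + (j * m + 1))%N by rewrite addn1 addSnnS.
by rewrite /sorted_gf_term -!qbinomE top0 top1 subn1.
Qed.

Definition block (j : nat) : Qqxt :=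
  t3 * x3 ^+ (j * m) / qden (j * m)%N
  - t3 * x3 ^+ (j * m + 1) / qden (j * m + 1)%N.

Lemma coef_block c j : [coef c] (block j.+1) = sorted_gf_term c j.+1.
Proof.
have jm_gt0 : (0 < j.+1 * m)%N by rewrite muln_gt0.
have jm1_gt0 : (0 < j.+1 * m + 1)%N by rewrite addn1.
rewrite /block /sorted_gf_term coef_fpsB.
exact: (f_equal2 (fun f g => f - g) (coef_t3x3_qden c jm_gt0)
                                    (coef_t3x3_qden c jm1_gt0)).
Qed.

(** Block 0 is split off: [t / (1 - t)] has t^0-coefficient 0, whereas the empty alphabet carries
    one empty word. *)
Definition block_sum : Qqxt := \fps_(c) (sorted_gf c - sorted_gf_term c 0).

Lemma sums_to3_block : sums_to3 (fun j => block j.+1) block_sum.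
Proof.
move=> a b c; exists b => n b_le; congr ([coef a] _).
rewrite coef_fps_sum; under eq_bigr do rewrite coef_block.
have -> : \sum_(j < n) sorted_gf_term c j.+1 =
          \sum_(j < n.+1) sorted_gf_term c j - sorted_gf_term c 0.
  by rewrite big_ord_recl addrC addKr; apply: eq_bigr => j _; rewrite lift0.
by rewrite coef_fpsB coef_sum_chi.
Qed.

(** The linear term supplies h_1 x, and block 0 of B_c is 1 - h_1 x, so together they leave 1 -
    B_c. *)
Lemma coef_hadamard_base c :
  [coef c] (t3 * x3 / ((1 - t3) * (1 - t3 * q3)) - block_sum) = 1 - sorted_gf c.
Proof.
have -> : (1 - t3) * (1 - t3 * q3) = qden 1 by rewrite qdenS qden0 expr1 mulrC.
rewrite -[x3]expr1 coef_fpsB coef_t3x3_qden // [[coef c] block_sum]/=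
  sorted_gf_term0 expr1.
by rewrite opprB addrA addrCA subrr addr0.
Qed.

Lemma coef_hadamard_exp f n c : [coef c] (hadamard_exp f n) = ([coef c] f) ^+ n.
Proof.
elim: n => [|n IHn]; last by rewrite exprS -IHn.
have -> : hadamard_exp f 0 = tseries (fun=> 1).
  have unit_t : 1 - t3 \is a GRing.unit by rewrite -qden0 qden_unit.
  by apply: (mulrI unit_t); rewrite one_subt_tseries divrr.
by [].
Qed.

Definition lhs_gf : Qqxt := \fps_(k) runfree_gf k.

Lemma sums_to3_hadamard f :
  (forall c, [coef c] f = 1 - sorted_gf c) -> sums_to3 (hadamard_exp f) lhs_gf.
Proof.
move=> fE a b c; exists b.+1 => n b_lt; congr ([coef a] _).
rewrite coef_fps_sum; under eq_bigr do rewrite coef_hadamard_exp fE.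
set B := sorted_gf c.
have coef0_B : [coef 0] (1 - B) = 0.
  rewrite coef_fpsB coef_fps1 [[coef 0] B]/= wsum_sorted0 mulr1.
  by rewrite /chi mod0n subr0 subrr.
have geom : B * \sum_(i < n) (1 - B) ^+ i = 1 - (1 - B) ^+ n.
  by rewrite -[RHS]opprB subrX1 -mulNr opprB subKr.
(* Multiplying [geom] by the inverse of [B] leaves a remainder divisible by [x^n], which does not
   reach [x^b] for [b < n]. *)
have -> : \sum_(i < n) (1 - B) ^+ i =
          runfree_gf c - runfree_gf c * (1 - B) ^+ n.
  rewrite -{1}[runfree_gf c]mulr1 -mulrBr -geom mulrA [_ * B]mulrC.
  by rewrite sorted_gf_runfree_gf mul1r.
rewrite coef_fpsB coef_fpsM big1 ?subr0 // => i _.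
by rewrite coef_fps_exp_eq0 ?mulr0 //; lia.
Qed.

Lemma sums_to3_lhs :
  sums_to3 (fun n => A_ides_imaj (incr_perm m) n / qden n * x3 ^+ n) lhs_gf.
Proof.
move=> a b c; exists b.+1 => n b_lt; congr ([coef a] _).
rewrite !coef_fps_sum (bigD1 (Ordinal b_lt)) // big1 => [|i neq_i];
  rewrite A_ides_imajE // mulrC coef_x3XM mulrC coef_fpsC_x2X.
  by rewrite eqxx mulr1 [LHS]addr0.
by rewrite eq_sym -val_eqE in neq_i; rewrite (negPf neq_i) mulr0.
Qed.

Lemma runfree_gf0 : runfree_gf 0 = 1.
Proof.
apply/fpsP => -[|n]; rewrite coef_fps1 /= /wsum_runfree ?wsum0 //.
by rewrite wsumS big_ord0.
Qed.

Lemma sorted_gf_unit k : sorted_gf k \is a GRing.unit.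
Proof.
by apply/unitrPr; exists (runfree_gf k); exact: sorted_gf_runfree_gf.
Qed.

Lemma sorted_gfV k : (sorted_gf k)^-1 = runfree_gf k.
Proof.
by rewrite -[LHS]mulr1 -(sorted_gf_runfree_gf k) mulKr // sorted_gf_unit.
Qed.

(** Over the empty alphabet only the empty word exists, so the t^0-coefficient of [lhs_gf] is 1,
    exactly what a sum starting at t^1 misses. *)
Lemma sums_to3_inverse (B : nat -> Qqx) :
  (forall k, B k.+1 = sorted_gf k.+1) ->
  sums_to3 (fun k => fpsC (B k.+1)^-1 * t3 ^+ k.+1) (lhs_gf - 1).
Proof.
move=> BE a b c; exists c => n c_le; congr ([coef a] ([coef b] _)).
rewrite coef_fps_sum coef_fpsB coef_fps1 [[coef c] lhs_gf]/=.
case: c c_le => [|c] c_lt.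
  rewrite runfree_gf0 subrr big1 // => i _.
  by rewrite coef_fpsCM coef_fpsXn mulr0.
rewrite subr0 (bigD1 (Ordinal c_lt)) // big1 => [|i neq_i];
  rewrite coef_fpsCM coef_fpsXn.
  by rewrite eqxx mulr1 [LHS]addr0 BE sorted_gfV.
by rewrite eq_sym -val_eqE in neq_i; rewrite eqSS (negPf neq_i) mulr0.
Qed.

End Main.

Theorem theorem4p2 (m : nat) (hm : (2 <= m)%N) :
  let den (n : nat) : Qqxt := \prod_(i < n.+1) (1 - t3 * q3 ^+ i) in
  let lhs_term (n : nat) : Qqxt :=
    A_ides_imaj (incr_perm m) n / den n * x3 ^+ n in
  let inner (j : nat) : Qqxt :=
    t3 * x3 ^+ (j * m) / den (j * m)%N
    - t3 * x3 ^+ (j * m + 1) / den (j * m + 1)%N in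
  let F : Qqxt :=
    t3 * x3 / ((1 - t3) * (1 - t3 * q3)) - fps_sum3 (fun j => inner j.+1) in
  let bracket_term (k j : nat) : Qqx :=
    fpsC (qbinom (k + j * m - 1) (k - 1)) * x2 ^+ (j * m)
    - fpsC (qbinom (k + j * m) (k - 1)) * x2 ^+ (j * m + 1) in
  let bracket (k : nat) : Qqx := fps_sum2 (bracket_term k) in
  let rhs_term (k : nat) : Qqxt := fpsC (bracket k)^-1 * t3 ^+ k in
  summable3 lhs_term
  /\ (* (a) *)
  [/\ summable3 (fun j => inner j.+1),
      summable3 (hadamard_exp F)
    & fps_sum3 lhs_term = fps_sum3 (hadamard_exp F)]
  /\ (* (b) *)
  [/\ forall k : nat, (1 <= k)%N ->
        summable2 (bracket_term k) /\ bracket k \is a GRing.unit,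
      summable3 (fun k => rhs_term k.+1)
    & fps_sum3 lhs_term = 1 + fps_sum3 (fun k => rhs_term k.+1)].
Proof.
move=> den lhs_term inner F bracket_term bracket rhs_term.
have lhs_sums : sums_to3 lhs_term (lhs_gf m) by exact: sums_to3_lhs.
have inner_sums : sums_to3 (fun j => inner j.+1) (block_sum m).
  exact: sums_to3_block.
have F_sums : sums_to3 (hadamard_exp F) (lhs_gf m).
  by apply: sums_to3_hadamard => // c; rewrite /F (fps_sum3P inner_sums)
    coef_hadamard_base.
have bracket_sums k : sums_to2 (bracket_term k.+1) (sorted_gf m k.+1).
  have -> : bracket_term k.+1 = sorted_gf_term m k.+1.
    by apply: boolp.funext => j; rewrite -bracket_termE.
  exact: sums_to2_sorted_gf.
have bracketE k : bracket k.+1 = sorted_gf m k.+1 := fps_sum2P (bracket_sums k).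
have rhs_sums := sums_to3_inverse hm bracketE.
split; first by exists (lhs_gf m).
split; split.
- by exists (block_sum m).
- by exists (lhs_gf m).
- by rewrite (fps_sum3P lhs_sums) (fps_sum3P F_sums).
- case=> // k _; split; first by exists (sorted_gf m k.+1).
  by rewrite bracketE sorted_gf_unit.
- by exists (lhs_gf m - 1).
- by rewrite (fps_sum3P lhs_sums) (fps_sum3P rhs_sums) addrC subrK.
Qed.
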